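(* Let $A\in\mathbb{C}^{m\times n}$ and $\mathbf{b}\in\mathbb{C}^m$ be such that $A\mathbf{x}=\mathbf{b}$ is consistent, assume $\|A\|_F^4\neq\|AA^*\|_F^2$, and let $\mathbf{x}_\star=A^\dagger\mathbf{b}$. Then the iterative sequence $\{\mathbf{x}_k\}$ generated by the two-dimensional randomized Kaczmarz method (described in the context) converges to $\mathbf{x}_\star$ for any initial vector $\mathbf{x}_0$ in expectation. Moreover, with $\overline{\mathbf{x}}_k=\mathbf{x}_k-\mathbf{x}_\star$, for $k=0,1,2,\dots$, $$\mathbb{E}\|\overline{\mathbf{x}}_{k+1}\|_2^2\le\left(1-\frac{2\|A\|_F^4-2\|A\|_F^2\|A\|_2^2}{\|A\|_F^4-\|AA^*\|_F^2}\,\frac{\lambda_{\min}(A^*A)}{\|A\|_F^2}\right)^{k+1}\|\overline{\mathbf{x}}_0\|_2^2.$$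
   Context: Here $A^\dagger$ is the Moore-Penrose pseudoinverse, $\mathbf{a}_i$ is the $i$-th row of $A$ (a row vector), $\mathbf{b}_i$ is the $i$-th entry of $\mathbf{b}$, $(\cdot)^*$ is the conjugate transpose, $\|\cdot\|_F$ is the Frobenius norm, $\|A\|_2$ is the largest singular value, and $\lambda_{\min}(A^*A)$ is the smallest nonzero eigenvalue of $A^*A$. The cross-product-like constant of two row vectors is $|\mathbf{x}\times\mathbf{y}|=\sqrt{\|\mathbf{x}\|_2^2\|\mathbf{y}\|_2^2-|\mathbf{x}\mathbf{y}^*|^2}$. Convergence in expectation means $\mathbb{E}\|\mathbf{x}_k-\mathbf{x}_\star\|_2^2\to0$. Two-dimensional randomized Kaczmarz method. Starting from $\mathbf{x}_0\in\mathbb{C}^n$, for $k=0,1,2,\dots$: select (independently of the past) an ordered pair of rows $(i_k,j_k)\in\{1,\dots,m\}^2$ with probability $$\frac{|\mathbf{a}_{i_k}\times\mathbf{a}_{j_k}|^2}{\|A\|_F^4-\|AA^*\|_F^2}$$ (pairs of parallel rows, in particular $i_k=j_k$, have probability $0$), and set $\mathbf{x}_{k+1}=\mathbf{x}_k+\gamma_k\mathbf{a}_{i_k}^*+\lambda_k\mathbf{a}_{j_k}^*$, where $$\gamma_k=\frac{\|\mathbf{a}_{j_k}\|_2^2(\mathbf{b}_{i_k}-\mathbf{a}_{i_k}\mathbf{x}_k)-\mathbf{a}_{i_k}\mathbf{a}_{j_k}^*(\mathbf{b}_{j_k}-\mathbf{a}_{j_k}\mathbf{x}_k)}{\|\mathbf{a}_{i_k}\|_2^2\|\mathbf{a}_{j_k}\|_2^2-|\mathbf{a}_{i_k}\mathbf{a}_{j_k}^*|^2},$$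 $$\lambda_k=\frac{\|\mathbf{a}_{i_k}\|_2^2(\mathbf{b}_{j_k}-\mathbf{a}_{j_k}\mathbf{x}_k)-\mathbf{a}_{j_k}\mathbf{a}_{i_k}^*(\mathbf{b}_{i_k}-\mathbf{a}_{i_k}\mathbf{x}_k)}{\|\mathbf{a}_{i_k}\|_2^2\|\mathbf{a}_{j_k}\|_2^2-|\mathbf{a}_{i_k}\mathbf{a}_{j_k}^*|^2}.$$
   Formalization: The initial vector x_0 is assumed to lie in the range of A^* instead of being arbitrary; for other x_0 the claim fails, since the component of x_0 in ker A never changes while x_⋆ = A^†b has none (e.g. rows e_1, e_2 in C^3, b = 0, x_0 = e_3). *)

(* Defs.v *)
From HB Require Import structures.
From mathcomp Require Import all_boot all_order all_algebra.
From mathcomp Require Import all_classical all_reals all_analysis.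
From mathcomp Require Export complex.

Set Implicit Arguments.
Unset Strict Implicit.
Unset Printing Implicit Defensive.

Import Order.TTheory GRing.Theory Num.Theory.
Import numFieldNormedType.Exports.

Local Open Scope classical_set_scope.
Local Open Scope ring_scope.
Local Open Scope complex_scope.
Local Open Scope sesquilinear_scope.

(* The complex numbers are R[i] for R : realType; `|z| lies in R[i] and has
   zero imaginary part. *)
Definition cabs (R : realType) (z : R[i]) : R := complex.Re `|z|.

(* The library's own norm on matrices is the max norm. On row and column
   vectors the Frobenius norm is the Euclidean norm. *)
Definition frob (R : realType) (m n : nat) (M : 'M[R[i]]_(m, n)) : R :=
  Num.sqrt (\sum_i \sum_j cabs (M i j) ^+ 2).

(* If m < n this set may also contain s = 0 although 0 is not one of the
   min(m, n) singular values; this does not affect the supremum. *)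
Definition singular_values (R : realType) (m n : nat) (M : 'M[R[i]]_(m, n)) :
    set R :=
  [set s : R | 0 <= s /\ eigenvalue (M^t* *m M) (s ^+ 2)%:C].

(* The suprema and infima below are over finite sets, so they are attained
   whenever the sets are nonempty. *)
Definition spectral_norm (R : realType) (m n : nat) (M : 'M[R[i]]_(m, n)) : R :=
  sup (singular_values M).

(* Intended for Hermitian G, whose eigenvalues are all real. *)
Definition lambda_min (R : realType) (n : nat) (G : 'M[R[i]]_n) : R :=
  inf [set t : R | t != 0 /\ eigenvalue G t%:C].

Definition penrose (R : realType) (m n : nat)
    (M : 'M[R[i]]_(m, n)) (X : 'M[R[i]]_(n, m)) : Prop :=
  [/\ M *m X *m M = M,
      X *m M *m X = X,
      (M *m X)^t* = M *m X &
      (X *m M)^t* = X *m M].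

(* MathComp's pinvmx is not the Moore-Penrose pseudoinverse. *)
Definition mp_pinv (R : realType) (m n : nat) (M : 'M[R[i]]_(m, n)) :
    'M[R[i]]_(n, m) :=
  xget 0 [set X | penrose M X].

Definition rdot (R : realType) (n : nat) (x y : 'rV[R[i]]_n) : R[i] :=
  (x *m y^t*) 0 0.

Definition cross (R : realType) (n : nat) (x y : 'rV[R[i]]_n) : R :=
  Num.sqrt (frob x ^+ 2 * frob y ^+ 2 - cabs (rdot x y) ^+ 2).

Section Kaczmarz.
Variables (R : realType) (m n : nat) (A : 'M[R[i]]_(m, n)) (b : 'cV[R[i]]_m).

Definition pair_prob (p : 'I_m * 'I_m) : R :=
  cross (row p.1 A) (row p.2 A) ^+ 2
    / (frob A ^+ 4 - frob (A *m A^t*) ^+ 2).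

Definition residual (i : 'I_m) (x : 'cV[R[i]]_n) : R[i] :=
  b i 0 - (row i A *m x) 0 0.

(* gamma is [coeff i j x] and lambda is [coeff j i x]: their formulas are
   exchanged by swapping the two rows. *)
Definition coeff (i j : 'I_m) (x : 'cV[R[i]]_n) : R[i] :=
  ((frob (row j A) ^+ 2)%:C * residual i x
     - rdot (row i A) (row j A) * residual j x)
  / (frob (row i A) ^+ 2 * frob (row j A) ^+ 2
     - cabs (rdot (row i A) (row j A)) ^+ 2)%:C.

(* For parallel rows the denominator vanishes and division by zero yields 0;
   such pairs have probability 0. *)
Definition kaczmarz_step (p : 'I_m * 'I_m) (x : 'cV[R[i]]_n) : 'cV[R[i]]_n :=
  x + coeff p.1 p.2 x *: (row p.1 A)^t* + coeff p.2 p.1 x *: (row p.2 A)^t*.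

Fixpoint kaczmarz (x0 : 'cV[R[i]]_n) (p : nat -> 'I_m * 'I_m) (k : nat) :
    'cV[R[i]]_n :=
  if k is k'.+1 then kaczmarz_step (p k') (kaczmarz x0 p k') else x0.

End Kaczmarz.

(* S carries the discrete sigma-algebra: every subset of S is measurable. *)
Definition mutually_independent (d : measure_display) (T : measurableType d)
    (R : realType) (P : probability T R) (S : finType) (X : nat -> T -> S) :
    Prop :=
  forall (s : seq nat) (B : nat -> set S), uniq s ->
    P (\bigcap_(l in [set` s]) (X l @^-1` B l))
    = (\prod_(l <- s) P (X l @^-1` B l))%E.

Definition row_sampling (d : measure_display) (T : measurableType d)
    (R : realType) (P : probability T R) (m n : nat) (A : 'M[R[i]]_(m, n))
    (p : nat -> T -> 'I_m * 'I_m) : Prop :=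
  [/\ forall k (B : set ('I_m * 'I_m)), measurable (p k @^-1` B),
      forall k q, P (p k @^-1` [set q]) = (pair_prob A q)%:E &
      mutually_independent P p].

(* Main.v *)
(* In terms of the error e = x - xstar, one step subtracts from e its
   orthogonal projection onto the span of the two chosen columns a_i^*, a_j^*,
   so |e|^2 drops by a quotient whose denominator is |a_i x a_j|^2.  The
   sampling weights cancel these denominators, and the mean decrease is
   2 (|A|_F^2 |Ae|^2 - |A^*Ae|^2) / N with N = |A|_F^4 - |AA^*|_F^2.  Diagonalizing
   A^*A gives |A^*Ae|^2 <= |A|_2^2 |Ae|^2 and, for e in the range of A^* (which
   the iteration preserves), |Ae|^2 >= lambda_min |e|^2.  Hence each step
   contracts E|e|^2 by the announced factor 1 - gain.  The gain is positive
   because N, the sum of the d_i d_j over i <> j for the eigenvalues d_i of A^*A,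
   is nonzero, which forces two nonzero eigenvalues. *)
Require Import Defs.
From mathcomp Require Import all_boot all_order all_algebra.
From mathcomp Require Import all_classical all_reals all_analysis.
From mathcomp Require Import measurable_realfun ring lra.
Import Order.TTheory GRing.Theory Num.Theory.
Import numFieldNormedType.Exports.

Set Implicit Arguments.
Unset Strict Implicit.
Unset Printing Implicit Defensive.

Local Open Scope classical_set_scope.
Local Open Scope ring_scope.
Local Open Scope complex_scope.
Local Open Scope sesquilinear_scope.

(** * Frobenius norms and conjugate transposes of complex matrices *)

Lemma real_complexM (R : realType) (a b : R) : (a * b)%:C = a%:C * b%:C.
Proof. exact: rmorphM. Qed.

Lemma real_complexB (R : realType) (a b : R) : (a - b)%:C = a%:C - b%:C.
Proof. exact: rmorphB. Qed.

Lemma conjC_real_complex (R : realType) (r : R) : ((r%:C)^* = r%:C)%R.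
Proof. by rewrite conj_Creal// complex_real. Qed.

Lemma cabs_sqr (R : realType) (z : R[i]) : (cabs z ^+ 2)%:C = (z * z^*)%R.
Proof.
by rewrite -normCK rmorphXn /= /cabs RRe_real// normr_real.
Qed.

Lemma frob_sqr (R : realType) m n (M : 'M[R[i]]_(m, n)) :
  frob M ^+ 2 = \sum_i \sum_j cabs (M i j) ^+ 2.
Proof. by rewrite sqr_sqrtr//; do 2![apply: sumr_ge0 => ? _]; rewrite sqr_ge0. Qed.

Lemma frob_sqrE (R : realType) m n (M : 'M[R[i]]_(m, n)) :
  (frob M ^+ 2)%:C = \tr (M *m M^t*).
Proof.
rewrite frob_sqr rmorph_sum; apply: eq_bigr => i _.
by rewrite rmorph_sum mxE; apply: eq_bigr => j _ /=; rewrite cabs_sqr !mxE.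
Qed.

Lemma frob_sqr_eq0 (R : realType) m n (M : 'M[R[i]]_(m, n)) : frob M ^+ 2 = 0 -> M = 0.
Proof.
rewrite frob_sqr => /eqP; rewrite psumr_eq0; last first.
  by move=> i _; apply: sumr_ge0 => j _; rewrite sqr_ge0.
move=> /allP M0; apply/matrixP => i j; rewrite mxE.
have := M0 i (mem_index_enum i); rewrite psumr_eq0; last first.
  by move=> ? _; rewrite sqr_ge0.
move=> /allP/(_ j (mem_index_enum j)) /= /eqP Mij.
by apply/eqP; rewrite -normr_eq0 -sqrf_eq0 normCK -cabs_sqr Mij.
Qed.

Lemma trmxC_mul (C : numClosedFieldType) m n p (M : 'M[C]_(m, n)) (N : 'M[C]_(n, p)) :
  (M *m N)^t* = N^t* *m M^t*.
Proof. by rewrite trmx_mul map_mxM. Qed.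

Lemma trmxCD (C : numClosedFieldType) m n (M N : 'M[C]_(m, n)) :
  (M + N)^t* = M^t* + N^t*.
Proof. by rewrite linearD map_mxD. Qed.

Lemma trmxCZ (C : numClosedFieldType) m n a (M : 'M[C]_(m, n)) :
  (a *: M)^t* = (a^*)%R *: M^t*.
Proof. by rewrite linearZ map_mxZ. Qed.

Lemma frob_sqr_col (R : realType) n (x : 'cV[R[i]]_n) :
  (frob x ^+ 2)%:C = (x^t* *m x) 0 0.
Proof. by rewrite frob_sqrE mxtrace_mulC /mxtrace big_ord1. Qed.

Lemma frob_sqr_row (R : realType) n (x : 'rV[R[i]]_n) :
  (frob x ^+ 2)%:C = rdot x x.
Proof. by rewrite frob_sqrE /mxtrace big_ord1. Qed.

Lemma rdotC (R : realType) n (x y : 'rV[R[i]]_n) : rdot y x = ((rdot x y)^*)%R.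
Proof.
rewrite /rdot -[y in LHS]trmxCK -trmxC_mul.
by rewrite !mxE.
Qed.

(** * The Gram determinant of two rows and Cauchy-Schwarz *)

Section TwoRows.
Variables (R : realType) (n : nat) (x y : 'rV[R[i]]_n).
Local Notation c := (rdot x y).
Local Notation D := (frob x ^+ 2 * frob y ^+ 2 - cabs c ^+ 2).

Lemma frob_sqr_lincomb (a b : R[i]) :
  ((frob (a *: x - b *: y) ^+ 2)%:C =
   a * a^* * (frob x ^+ 2)%:C + b * b^* * (frob y ^+ 2)%:C
   - a * b^* * rdot x y - a^* * b * rdot y x)%R.
Proof.
rewrite !frob_sqr_row /rdot -scaleNr trmxCD !trmxCZ raddfN.
rewrite mulmxDl !mulmxDr -!scalemxAl -!scalemxAr !scalerA.
move: (x *m x^t*) (x *m y^t*) (y *m x^t*) (y *m y^t*) => xx xy yx yy.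
by rewrite !mxE; ring.
Qed.

(** The vector is |y|^2 times the component of x orthogonal to y; clearing the denominator keeps the
    identity valid for y = 0. It yields Cauchy-Schwarz and its equality case. *)
Lemma frob_sqr_gram_schmidt :
  frob (((frob y ^+ 2)%:C) *: x - c *: y) ^+ 2 = frob y ^+ 2 * D.
Proof.
apply: complexI; rewrite frob_sqr_lincomb (rdotC x y) conjC_real_complex.
rewrite (real_complexM (_ ^+ 2) (_ - _)) real_complexB.
by rewrite (real_complexM (frob x ^+ 2)) cabs_sqr; ring.
Qed.

Lemma gram_det_ge0 : 0 <= D.
Proof.
have [y0|y0] := eqVneq (frob y ^+ 2) 0.
  have -> : rdot x y = 0 by rewrite (frob_sqr_eq0 y0) /rdot linear0 map_mx0 mulmx0 mxE.
  by rewrite y0 mulr0 /cabs normr0 expr0n subrr.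
have yp : 0 < frob y ^+ 2 by rewrite lt_neqAle eq_sym y0 sqr_ge0.
by rewrite -(pmulr_rge0 _ yp) -frob_sqr_gram_schmidt sqr_ge0.
Qed.

Lemma cross_sqr : cross x y ^+ 2 = D.
Proof. by rewrite sqr_sqrtr// gram_det_ge0. Qed.
End TwoRows.

Lemma cross_sqrC (R : realType) n (x y : 'rV[R[i]]_n) :
  (cross x y ^+ 2)%:C =
   ((frob x ^+ 2)%:C * (frob y ^+ 2)%:C - rdot x y * (rdot x y)^*)%R.
Proof. by rewrite cross_sqr real_complexB (real_complexM (frob x ^+ 2)) cabs_sqr. Qed.

(** Equality in Cauchy-Schwarz: the Gram-Schmidt residual has norm 0. *)
Lemma cross_eq0_parallel (R : realType) n (x y : 'rV[R[i]]_n) : cross x y = 0 ->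
  (frob y ^+ 2)%:C *: x = rdot x y *: y.
Proof.
move=> xy0; apply/eqP; rewrite -subr_eq0; apply/eqP; apply: frob_sqr_eq0.
by rewrite frob_sqr_gram_schmidt -cross_sqr xy0 expr0n mulr0.
Qed.

(** * Effect of one step on the squared error *)

Section Step.
Variables (R : realType) (n : nat) (x y : 'rV[R[i]]_n) (e : 'cV[R[i]]_n).
Local Notation r := ((x *m e) 0 0).
Local Notation s := ((y *m e) 0 0).
Local Notation c := (rdot x y).

(* The product of |x cross y|^2 with the squared length of the projection of [e]
   onto the span of [x^t*] and [y^t*]. *)
Definition descent : R[i] :=
  ((frob y ^+ 2)%:C * (r * r^*) + (frob x ^+ 2)%:C * (s * s^*)
   - c * s * r^* - c^* * r * s^*)%R.

(* Pairs of parallel rows have probability 0, so their terms must vanish from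
   the sum of [descent] over all pairs. *)
Lemma descent_eq0 : cross x y = 0 -> descent = 0.
Proof.
move=> xy0.
have yx0 : cross y x = 0.
  by rewrite -xy0 /cross rdotC mulrC /cabs norm_conjC.
have rs : (frob y ^+ 2)%:C * r = c * s.
  have /(congr1 (fun z : 'rV_n => (z *m e) 0 0)) := cross_eq0_parallel xy0.
  by rewrite -!scalemxAl mxE => ->; rewrite mxE.
have sr : (frob x ^+ 2)%:C * s = (c^*)%R * r.
  have /(congr1 (fun z : 'rV_n => (z *m e) 0 0)) := cross_eq0_parallel yx0.
  by rewrite -!scalemxAl mxE => ->; rewrite mxE rdotC.
by rewrite /descent !mulrA rs sr; ring.
Qed.

Lemma frob_sqr_step (g l : R[i]) :
  (frob (e + g *: x^t* + l *: y^t*) ^+ 2)%:C =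
  ((frob e ^+ 2)%:C + g * r^* + g^* * r + l * s^* + l^* * s
   + g * g^* * (frob x ^+ 2)%:C + l * l^* * (frob y ^+ 2)%:C
   + g^* * l * c + l^* * g * c^*)%R.
Proof.
have re : (e^t* *m x^t*) 0 0 = (r^*)%R by rewrite -trmxC_mul !mxE.
have se : (e^t* *m y^t*) 0 0 = (s^*)%R by rewrite -trmxC_mul !mxE.
rewrite -re -se -rdotC !frob_sqr_col !frob_sqr_row /rdot.
rewrite !trmxCD !trmxCZ !trmxCK.
rewrite !mulmxDl !mulmxDr -!scalemxAl -!scalemxAr !scalerA.
move: (x *m x^t*) (x *m y^t*) (y *m x^t*) (y *m y^t*) => xx xy yx yy.
move: (e^t* *m e) (x *m e) (y *m e) (e^t* *m x^t*) (e^t* *m y^t*) => ee xe ye ex ey.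
by rewrite !mxE; ring.
Qed.

(** By Cramer's rule these coefficients make the new vector vanish under both x and y, so the step
    is an orthogonal projection and Pythagoras gives the drop. Multiplying by the Gram determinant
    keeps [descent] free of division. *)
Lemma projection_step : cross x y != 0 ->
  (cross x y ^+ 2)%:C * (frob (e
     + ((c * s - (frob y ^+ 2)%:C * r) / (cross x y ^+ 2)%:C) *: x^t*
     + (((c^*)%R * r - (frob x ^+ 2)%:C * s) / (cross x y ^+ 2)%:C) *: y^t*) ^+ 2)%:C =
  (cross x y ^+ 2)%:C * (frob e ^+ 2)%:C - descent.
Proof.
move=> xy0; rewrite frob_sqr_step /descent.
have D0 : (cross x y ^+ 2)%:C != 0.
  by apply: contra_neq xy0 => /complexI/eqP; rewrite sqrf_eq0 => /eqP.
move: D0 (conjC_real_complex (cross x y ^+ 2)) (cross_sqrC x y).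
move: (conjC_real_complex (frob x ^+ 2)) (conjC_real_complex (frob y ^+ 2)).
move: (_ ^+ 2)%:C (_ ^+ 2)%:C (_ ^+ 2)%:C (_ ^+ 2)%:C => E D Y X.
move: (rdot x y) (fun_of_matrix _ 0 0) (fun_of_matrix _ 0 0) => c r s XJ YJ D0 DJ defD.
rewrite !(rmorphM, rmorphB, fmorphV) /= !conjCK XJ YJ DJ.
by move: D0; rewrite defD => D0; field.
Qed.
End Step.

(** * Mean decrease over the random pair of rows *)

Section MeanDecrease.
Variables (R : realType) (m n : nat) (A : 'M[R[i]]_(m, n)).
Local Notation F2 := (frob A ^+ 2).
Local Notation N := (frob A ^+ 4 - frob (A *m A^t*) ^+ 2).

Lemma rdot_rows i j : rdot (row i A) (row j A) = (A *m A^t*) i j.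
Proof. by rewrite /rdot !mxE; apply: eq_bigr => k _; rewrite !mxE. Qed.

Lemma row_mulE p (B : 'M[R[i]]_(n, p)) i k : (row i A *m B) 0 k = (A *m B) i k.
Proof. by rewrite -row_mul mxE. Qed.

Lemma sum_frob_row : \sum_i frob (row i A) ^+ 2 = F2.
Proof.
rewrite frob_sqr; apply: eq_bigr => i _.
by rewrite frob_sqr big_ord1; apply: eq_bigr => j _; rewrite mxE.
Qed.

(** The products |a_i|^2 |a_j|^2 sum to |A|_F^4, and the a_i a_j^* are the entries of AA^*. Thus N
    is the normalizing constant of the pair weights, and it is nonnegative. *)
Lemma sum_cross : \sum_i \sum_j cross (row i A) (row j A) ^+ 2 = N.
Proof.
under eq_bigr => i _.
  under eq_bigr => j _ do rewrite cross_sqr rdot_rows.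
  rewrite sumrB -mulr_sumr sum_frob_row; over.
by rewrite sumrB -mulr_suml sum_frob_row -exprD -frob_sqr.
Qed.

Lemma pair_prob_ge0 q : 0 <= pair_prob A q.
Proof.
by rewrite divr_ge0 ?sqr_ge0// -sum_cross; do 2![apply: sumr_ge0 => ? _]; rewrite sqr_ge0.
Qed.

(** Each square term of [descent] sums to |A|_F^2 |Ae|^2. The two mixed terms are exchanged by
    swapping i and j, and each sums to the quadratic form of AA^* at Ae. *)
Lemma sum_descent (e : 'cV[R[i]]_n) :
  \sum_i \sum_j descent (row i A) (row j A) e =
  (2 * F2 * frob (A *m e) ^+ 2 - 2 * frob (A^t* *m (A *m e)) ^+ 2)%:C.
Proof.
have sumF : \sum_i (frob (row i A) ^+ 2)%:C = F2%:C.
  by rewrite -sum_frob_row rmorph_sum.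
have sumr : \sum_i ((A *m e) i 0 * ((A *m e) i 0)^*)%R = (frob (A *m e) ^+ 2)%:C.
  by rewrite frob_sqr_col mxE; apply: eq_bigr => i _; rewrite !mxE mulrC.
have sumc : \sum_i \sum_j ((A *m A^t*) i j * (A *m e) j 0 * ((A *m e) i 0)^*)%R
    = (frob (A^t* *m (A *m e)) ^+ 2)%:C.
  rewrite frob_sqr_col trmxC_mul trmxCK -!mulmxA (mulmxA A) mxE.
  apply: eq_bigr => i _; rewrite [X in _ * X]mxE mulr_sumr.
  by apply: eq_bigr => j _; rewrite !mxE; ring.
have -> : \sum_i \sum_j descent (row i A) (row j A) e =
    \sum_i \sum_j ((frob (row j A) ^+ 2)%:C * ((A *m e) i 0 * ((A *m e) i 0)^*)%R)
    + \sum_i \sum_j ((frob (row i A) ^+ 2)%:C * ((A *m e) j 0 * ((A *m e) j 0)^*)%R)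
    - \sum_i \sum_j ((A *m A^t*) i j * (A *m e) j 0 * ((A *m e) i 0)^*)%R
    - \sum_i \sum_j ((A *m A^t*) j i * (A *m e) i 0 * ((A *m e) j 0)^*)%R.
  rewrite -big_split -!sumrB; apply: eq_bigr => i _.
  rewrite -big_split -!sumrB; apply: eq_bigr => j _.
  by rewrite /descent -rdotC !rdot_rows !row_mulE.
rewrite [X in _ - X]exchange_big [X in _ + X - _ - _]exchange_big /= sumc.
under eq_bigr do rewrite -mulr_suml sumF.
rewrite -mulr_sumr sumr real_complexB -mulrA (real_complexM 2) (real_complexM F2).
rewrite (real_complexM 2 (_ ^+ 2)) (_ : 2%:C = 2); last exact: rmorph_nat.
by ring.
Qed.

Variables (b : 'cV[R[i]]_m) (xs : 'cV[R[i]]_n).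
Hypothesis solution : A *m xs = b.

(** Consistency makes the residual linear in the error, so the whole step can be written in terms of
    errors. *)
Lemma residualE i x : residual A b i x = - (row i A *m (x - xs)) 0 0.
Proof.
rewrite /residual !row_mulE mulmxBr solution.
by move: (A *m x) => z; rewrite !mxE opprB.
Qed.

Lemma coeffE i j x :
  coeff A b i j x = (rdot (row i A) (row j A) * (row j A *m (x - xs)) 0 0
    - (frob (row j A) ^+ 2)%:C * (row i A *m (x - xs)) 0 0)
   / (cross (row i A) (row j A) ^+ 2)%:C.
Proof. by rewrite /coeff !residualE cross_sqr; congr (_ / _); ring. Qed.

Lemma kaczmarz_step_descent q x :
  (cross (row q.1 A) (row q.2 A) ^+ 2 * frob (kaczmarz_step A b q x - xs) ^+ 2)%:C =
  (cross (row q.1 A) (row q.2 A) ^+ 2 * frob (x - xs) ^+ 2)%:C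
   - descent (row q.1 A) (row q.2 A) (x - xs).
Proof.
(* For a parallel pair both the weight and [descent] vanish, so the default value of the division by
   zero in the step is harmless. *)
have [q0|q0] := eqVneq (cross (row q.1 A) (row q.2 A)) 0.
  by rewrite descent_eq0// q0 expr0n !mul0r subr0.
rewrite !(real_complexM (cross _ _ ^+ 2)) -projection_step//; congr (_ * (frob _ ^+ 2)%:C).
have crossC : cross (row q.2 A) (row q.1 A) = cross (row q.1 A) (row q.2 A).
  by rewrite /cross rdotC mulrC /cabs norm_conjC.
rewrite /kaczmarz_step !coeffE crossC -rdotC.
move: (_ *: (row q.1 A)^t*) (_ *: (row q.2 A)^t*) => u v.
by rewrite (addrAC _ v) (addrAC _ u).
Qed.

Lemma mean_kaczmarz_step (x : 'cV[R[i]]_n) : N != 0 ->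
  \sum_q pair_prob A q * frob (kaczmarz_step A b q x - xs) ^+ 2 =
  frob (x - xs) ^+ 2 -
   (2 * F2 * frob (A *m (x - xs)) ^+ 2 - 2 * frob (A^t* *m (A *m (x - xs))) ^+ 2) / N.
Proof.
move=> N0; under eq_bigr do rewrite mulrAC.
rewrite -mulr_suml; apply: (canLR (mulfK N0)); rewrite mulrBl mulfVK//.
apply: complexI; rewrite rmorph_sum real_complexB -sum_descent.
under eq_bigr do rewrite /= kaczmarz_step_descent.
rewrite sumrB (pair_bigA _ (fun i j => descent (row i A) (row j A) (x - xs))) /=.
congr (_ - _); rewrite -rmorph_sum /= -mulr_suml mulrC.
by rewrite -(pair_bigA _ (fun i j => cross (row i A) (row j A) ^+ 2)) sum_cross.
Qed.

End MeanDecrease.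

(** * Spectral decomposition of A^*A *)

Lemma unitarymx_trmxC_mul (C : numClosedFieldType) n (P : 'M[C]_n) :
  P \is unitarymx -> P^t* *m P = 1%:M.
Proof. by move=> uP; rewrite -invmx_unitary// mulVmx// unitarymx_unit. Qed.

Lemma frob_unitary (R : realType) m n (P : 'M[R[i]]_m) (M : 'M[R[i]]_(m, n)) :
  P \is unitarymx -> frob (P *m M) ^+ 2 = frob M ^+ 2.
Proof.
move=> uP; apply: complexI; rewrite !frob_sqrE trmxC_mul.
by rewrite mxtrace_mulC mulmxA -(mulmxA _ _ P) unitarymx_trmxC_mul// mulmx1 mxtrace_mulC.
Qed.

Section Spectrum.
Variables (R : realType) (m n : nat) (A : 'M[R[i]]_(m, n)).
Local Notation G := (A^t* *m A).

Let P : 'M[R[i]]_n := spectralmx G.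
Let uP : P \is unitarymx := spectral_unitarymx G.
Let PPt : P *m P^t* = 1%:M := elimT unitarymxP uP.

(* A squared norm equal to the [i]-th diagonal entry of P A^*A P^*: this makes the
   eigenvalue a real number, nonnegative, and 0 only when row i of P A^* is 0. *)
Definition gram_eigenval (i : 'I_n) : R := frob (row i (P *m A^t*)) ^+ 2.
Local Notation d := gram_eigenval.
Let Dm : 'M[R[i]]_n := diag_mx (\row_i (d i)%:C).

Lemma gram_eigenval_ge0 i : 0 <= d i.
Proof. exact: sqr_ge0. Qed.

(** A^*A is Hermitian, so the spectral theorem applies; its eigenvalues are then read off the
    diagonal of P A^*A P^*. *)
Let gram_spectral : G = P^t* *m Dm *m P.
Proof.
have normG : G \is normalmx by apply/normalmxP; rewrite trmxC_mul trmxCK.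
have GE := orthomx_spectralP normG.
rewrite {1}GE invmx_unitary//; congr (_ *m diag_mx _ *m _).
apply/rowP => i; rewrite mxE frob_sqr_row rdot_rows trmxC_mul trmxCK.
have -> : P *m A^t* *m (A *m P^t*) = P *m G *m P^t* by rewrite !mulmxA.
rewrite {2}GE invmx_unitary// !mulmxA PPt mul1mx.
by rewrite -mulmxA PPt mulmx1 mxE eqxx.
Qed.

Lemma eigenvalue_gramP a : reflect (exists i, a = (d i)%:C) (eigenvalue G a).
Proof.
have PG : P *m G = Dm *m P.
  by rewrite gram_spectral !mulmxA PPt mul1mx.
apply: (iffP eigenvalueP) => [[v vG v0]|[i ->]].
  (* In the eigenbasis the matrix is diagonal, so any nonzero coordinate of the eigenvector
     determines [a]. *)
  have wD : (v *m P^t*) *m Dm = a *: (v *m P^t*).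
    rewrite scalemxAl -vG gram_spectral !mulmxA.
    by rewrite -[RHS]mulmxA PPt mulmx1.
  have /rV0Pn[i wi] : v *m P^t* != 0.
    apply: contra_neq v0 => w0.
    by rewrite -[v]mulmx1 -(unitarymx_trmxC_mul uP) mulmxA w0 mul0mx.
  exists i; apply: (mulIf wi).
  have /rowP/(_ i) := wD.
  by rewrite mul_mx_diag !mxE mulrC => ->.
(* This row is a left eigenvector, nonzero because its squared norm is a diagonal entry of P P^* =
   1. *)
exists (row i P).
  by rewrite -row_mul PG row_mul row_diag_mx -scalemxAl -rowE mxE.
apply/eqP => Pi0; have := PPt => /matrixP/(_ i i).
rewrite -rdot_rows Pi0 /rdot mul0mx !mxE eqxx => /esym/eqP.
by rewrite oner_eq0.
Qed.

Lemma sum_gram_eigenval : \sum_i d i = frob A ^+ 2.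
Proof.
apply: complexI; rewrite frob_sqrE mxtrace_mulC gram_spectral mxtrace_mulC.
rewrite mulmxA PPt mul1mx mxtrace_diag rmorph_sum.
by apply: eq_bigr => i _; rewrite mxE.
Qed.

(** Cyclicity of the trace turns |AA^*|_F^2 into the trace of (A^*A)^2. *)
Lemma sum_gram_eigenval_sqr : \sum_i d i ^+ 2 = frob (A *m A^t*) ^+ 2.
Proof.
apply: complexI; rewrite frob_sqrE trmxC_mul trmxCK mulmxA mxtrace_mulC.
rewrite !mulmxA -[_ *m _ *m _ *m A]mulmxA gram_spectral.
rewrite -!mulmxA (mulmxA P) PPt mul1mx mxtrace_mulC -!mulmxA.
rewrite PPt mulmx1 mulmx_diag mxtrace_diag rmorph_sum.
by apply: eq_bigr => i _; rewrite !mxE -real_complexM.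
Qed.

(** Squared moduli of the coordinates of [e] in the eigenbasis; the squared norms of e, Ae and A^*Ae
    become their sums with weights 1, d_i and d_i^2. *)
Definition gram_coord (e : 'cV[R[i]]_n) (i : 'I_n) : R :=
  cabs ((spectralmx G *m e) i 0) ^+ 2.

Section Coordinates.
Variable e : 'cV[R[i]]_n.
Local Notation y := (gram_coord e).

Lemma frob_coord : frob e ^+ 2 = \sum_i y i.
Proof.
by rewrite -(frob_unitary _ uP) frob_sqr; apply: eq_bigr => i _; rewrite big_ord1.
Qed.

Lemma frob_mul_coord : frob (A *m e) ^+ 2 = \sum_i d i * y i.
Proof.
apply: complexI; rewrite frob_sqr_col trmxC_mul.
have -> : e^t* *m A^t* *m (A *m e) = (P *m e)^t* *m (Dm *m (P *m e)).
  by rewrite trmxC_mul !mulmxA -(mulmxA _ _ A) gram_spectral !mulmxA.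
rewrite mxE rmorph_sum; apply: eq_bigr => i _ /=.
rewrite /gram_coord -/P real_complexM cabs_sqr mul_diag_mx; move: (P *m e) => w.
by rewrite !mxE; ring.
Qed.

Lemma frob_gram_coord : frob (A^t* *m (A *m e)) ^+ 2 = \sum_i d i ^+ 2 * y i.
Proof.
rewrite mulmxA gram_spectral -!mulmxA.
rewrite (frob_unitary _ (_ : P^t* \is unitarymx)) ?trmxC_unitary//.
rewrite frob_sqr; apply: eq_bigr => i _; rewrite big_ord1.
rewrite /gram_coord -/P mul_diag_mx; move: (P *m e) => w; rewrite 2!mxE.
apply: complexI; rewrite cabs_sqr (real_complexM (d i ^+ 2)) cabs_sqr.
by rewrite [X in _ * X = _]rmorphM /= conjC_real_complex (real_complexM (d i)); ring.
Qed.

(** If d_i = 0 then row i of P A^* is zero, so a vector in the range of A^* has no component along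
    that eigenvector. *)
Lemma gram_coord_eq0 z i : e = A^t* *m z -> d i = 0 -> y i = 0.
Proof.
move=> eE /frob_sqr_eq0 di0; rewrite /gram_coord -/P eE mulmxA -row_mulE di0 mul0mx mxE.
by rewrite /cabs normr0 expr0n.
Qed.

Lemma gram_coord_ge0 i : 0 <= y i. Proof. exact: sqr_ge0. Qed.
End Coordinates.

(** * Largest and smallest nonzero eigenvalues of A^*A *)

Local Notation F2 := (frob A ^+ 2).
Local Notation N := (frob A ^+ 4 - frob (A *m A^t*) ^+ 2).

Lemma gram_eigenval_gt0 i : d i != 0 -> 0 < d i.
Proof. by move=> di0; rewrite lt_neqAle eq_sym di0 gram_eigenval_ge0. Qed.

Lemma gram_defect_gt0 : N != 0 -> 0 < N.
Proof.
move=> N0; rewrite lt_neqAle eq_sym N0 -sum_cross.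
by do 2![apply: sumr_ge0 => ? _]; rewrite sqr_ge0.
Qed.

Lemma gram_eigenval_neq0 : N != 0 -> exists i, d i != 0.
Proof.
move=> N0; apply/existsP; apply: contra_neqT N0 => /existsPn d0.
have {}d0 i : d i = 0 by apply/eqP; move: (d0 i); rewrite negbK.
rewrite -sum_gram_eigenval_sqr (exprM _ 2 2) -sum_gram_eigenval.
by rewrite !big1 ?expr0n ?subrr// => i _; rewrite d0// expr0n.
Qed.

(** The condition on N supplies an index, so a largest d_k exists and the supremum is attained at
    its square root. *)
Lemma spectral_norm_sqr : N != 0 ->
  exists2 k, spectral_norm A ^+ 2 = d k & forall i, d i <= d k.
Proof.
move=> /gram_eigenval_neq0[i0 _].
have [k _ dk] := @arg_maxP _ _ _ i0 xpredT d isT.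
exists k => [|i]; last exact: dk.
suff -> : spectral_norm A = Num.sqrt (d k) by rewrite sqr_sqrtr// gram_eigenval_ge0.
have ubk : ubound (singular_values A) (Num.sqrt (d k)).
  move=> s [s0 /eigenvalue_gramP[i /complexI s2]].
  by rewrite -(ger0_norm s0) -sqrtr_sqr s2 ler_wsqrtr//; exact: dk.
have ink : singular_values A (Num.sqrt (d k)).
  split; first exact: sqrtr_ge0.
  by apply/eigenvalue_gramP; exists k; rewrite sqr_sqrtr// gram_eigenval_ge0.
apply/eqP; rewrite eq_le; apply/andP; split.
  by apply: ge_sup => //; exists (Num.sqrt (d k)).
by apply: ub_le_sup => //; exists (Num.sqrt (d k)).
Qed.

Lemma lambda_min_gram : N != 0 ->
  exists2 k, d k != 0 & lambda_min G = d k /\ forall i, d i != 0 -> d k <= d i.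
Proof.
move=> /gram_eigenval_neq0[i0 di0].
have [k dk0 dk] := @arg_minP _ _ _ i0 (fun i => d i != 0) d di0.
exists k => //; split=> //; rewrite /lambda_min; set S := [set _ | _].
have lbk : lbound S (d k).
  by move=> t [t0 /eigenvalue_gramP[i /complexI ti]]; rewrite ti; apply: dk; rewrite -ti.
have ink : S (d k) by split=> //; apply/eigenvalue_gramP; exists k.
apply/eqP; rewrite eq_le; apply/andP; split.
  by apply: ge_inf => //; exists (d k).
by apply: lb_le_inf => //; exists (d k).
Qed.

Lemma lambda_min_gt0 : N != 0 -> 0 < lambda_min G.
Proof. by move=> /lambda_min_gram[k dk0 [-> _]]; exact: gram_eigenval_gt0. Qed.

(** Equality would force every eigenvalue but the largest d_k to vanish, and then N = d_k^2 - d_k^2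
    = 0. *)
Lemma spectral_norm_lt_frob : N != 0 -> spectral_norm A ^+ 2 < F2.
Proof.
move=> N0; have [k -> dk] := spectral_norm_sqr N0.
rewrite -sum_gram_eigenval (bigD1 k)//= ltrDl lt_neqAle.
rewrite sumr_ge0 ?andbT => [|i _]; last exact: gram_eigenval_ge0.
apply: contra_neq N0 => /esym/psumr_eq0P dk0.
have {}dk0 i : i != k -> d i = 0 by apply: dk0 => j _; exact: gram_eigenval_ge0.
rewrite -sum_gram_eigenval_sqr (exprM _ 2 2) -sum_gram_eigenval.
have -> : \sum_i d i = d k by rewrite (bigD1 k)//= big1 ?addr0.
have -> : \sum_i d i ^+ 2 = d k ^+ 2; last by rewrite subrr.
by rewrite (bigD1 k)//= big1 ?addr0// => i /dk0 ->; rewrite expr0n.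
Qed.

Lemma frob_gram_le (e : 'cV[R[i]]_n) : N != 0 ->
  frob (A^t* *m (A *m e)) ^+ 2 <= spectral_norm A ^+ 2 * frob (A *m e) ^+ 2.
Proof.
move=> N0; have [k -> dk] := spectral_norm_sqr N0.
rewrite frob_gram_coord frob_mul_coord mulr_sumr; apply: ler_sum => i _.
rewrite mulrA ler_wpM2r ?gram_coord_ge0// expr2.
by rewrite ler_wpM2r ?gram_eigenval_ge0.
Qed.

Lemma lambda_min_le (z : 'cV[R[i]]_m) : N != 0 ->
  lambda_min G * frob (A^t* *m z) ^+ 2 <= frob (A *m (A^t* *m z)) ^+ 2.
Proof.
move=> N0; have [k _ [-> dk]] := lambda_min_gram N0.
rewrite frob_mul_coord frob_coord mulr_sumr; apply: ler_sum => i _.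
(* Zero eigenvalues violate the bound by [lambda_min], but the range of A^* has no coordinate
   there. *)
have [di0|di0] := eqVneq (d i) 0.
  by rewrite (gram_coord_eq0 (erefl _) di0) !mulr0.
by rewrite ler_wpM2r ?gram_coord_ge0// dk.
Qed.

(** * The contraction factor of one step *)

Definition kaczmarz_gain : R :=
  (2 * frob A ^+ 4 - 2 * F2 * spectral_norm A ^+ 2) / N * (lambda_min G / F2).

Lemma kaczmarz_gainE : N != 0 ->
  kaczmarz_gain = 2 * (F2 - spectral_norm A ^+ 2) * lambda_min G / N.
Proof.
move=> N0; have F0 : F2 != 0.
  by rewrite gt_eqF// (le_lt_trans _ (spectral_norm_lt_frob N0))// sqr_ge0.
rewrite /kaczmarz_gain; move: (frob (_ *m _)) N0 => K N0.
have {}F0 : frob A != 0 by move: F0; rewrite sqrf_eq0.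
by field; rewrite N0.
Qed.

Lemma kaczmarz_gain_gt0 : N != 0 -> 0 < kaczmarz_gain.
Proof.
move=> N0; rewrite kaczmarz_gainE// divr_gt0 ?gram_defect_gt0//.
by rewrite !mulr_gt0 ?lambda_min_gt0// subr_gt0 spectral_norm_lt_frob.
Qed.

Lemma mean_kaczmarz_step_le b xs (x : 'cV[R[i]]_n) z : N != 0 ->
  A *m xs = b -> x - xs = A^t* *m z ->
  \sum_q pair_prob A q * frob (kaczmarz_step A b q x - xs) ^+ 2
    <= (1 - kaczmarz_gain) * frob (x - xs) ^+ 2.
Proof.
move=> N0 bE xE; rewrite (mean_kaczmarz_step bE)// [leRHS]mulrBl mul1r lerD2l lerN2.
rewrite kaczmarz_gainE// mulrAC ler_pM2r ?invr_gt0 ?gram_defect_gt0//.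
have := frob_gram_le (x - xs) N0; have := lambda_min_le z N0; rewrite -xE.
have := spectral_norm_lt_frob N0; rewrite -subr_gt0.
move: (frob (A *m (x - xs)) ^+ 2) (frob (x - xs) ^+ 2) => a e.
move: (frob (A^t* *m _) ^+ 2) (lambda_min G) => g l.
move: F2 (spectral_norm A ^+ 2) => f s sf la gs.
(* The chain is f a - g >= (f - s) a >= (f - s) l e; the second inequality uses f - s >= 0. *)
have := ler_wpM2l (ltW sf) la; lra.
Qed.

(* The witness is G^+ A^*, where G^+ inverts the nonzero eigenvalues of G = A^*A
   (0^-1 = 0 handles the others). *)
Lemma penrose_exists : exists X, penrose A X.
Proof.
pose Dp : 'M[R[i]]_n := diag_mx (\row_i ((d i)^-1)%:C).
pose Gp := P^t* *m Dp *m P.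
have mulP (U V : 'M[R[i]]_n) :
    (P^t* *m U *m P) *m (P^t* *m V *m P) = P^t* *m (U *m V) *m P.
  by rewrite !mulmxA -(mulmxA _ P) PPt mulmx1.
have tDp : Dp^t* = Dp.
  rewrite tr_diag_mx map_diag_mx; congr diag_mx; apply/rowP => i.
  by rewrite !mxE; exact: conjC_real_complex.
have tGp : Gp^t* = Gp by rewrite /Gp !trmxC_mul trmxCK tDp mulmxA.
have tG : G^t* = G by rewrite trmxC_mul trmxCK.
have GGp : G *m Gp = Gp *m G.
  by rewrite gram_spectral /Gp !mulP diag_mxC.
have GGpG : G *m Gp *m G = G.
  rewrite gram_spectral /Gp !mulP; congr (_ *m _ *m _).
  rewrite !mulmx_diag; congr diag_mx; apply/rowP => i; rewrite !mxE -!real_complexM.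
  have [->|di0] := eqVneq (d i) 0; first by rewrite mulr0.
  by congr _%:C; field.
have GpGGp : Gp *m G *m Gp = Gp.
  rewrite gram_spectral /Gp !mulP; congr (_ *m _ *m _).
  rewrite !mulmx_diag; congr diag_mx; apply/rowP => i; rewrite !mxE -!real_complexM.
  have [->|di0] := eqVneq (d i) 0; first by rewrite invr0 mulr0.
  by congr _%:C; field.
(* The squared norm is the trace of (1 - G^+ G)^* G (1 - G^+ G), and G (1 - G^+ G) = 0. *)
have AGpG : A *m (1%:M - Gp *m G) = 0.
  apply: frob_sqr_eq0; apply: complexI; rewrite frob_sqrE mxtrace_mulC trmxC_mul.
  rewrite -mulmxA (mulmxA _ A) (mulmxBr G) mulmx1 (mulmxA G) GGpG subrr mulmx0.
  exact: mxtrace0.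
clearbody Gp; exists (Gp *m A^t*); split.
- apply/esym; move/eqP: AGpG; rewrite mulmxBr mulmx1 subr_eq0 !mulmxA.
  by move=> /eqP.
- by rewrite (mulmxA _ Gp) -(mulmxA Gp _ A) GpGGp.
- by rewrite !trmxC_mul trmxCK tGp mulmxA.
- by rewrite -mulmxA trmxC_mul tGp tG.
Qed.

Lemma mp_pinvP : penrose A (mp_pinv A).
Proof. exact: (xgetPex 0 penrose_exists). Qed.

Lemma mp_pinv_solution (b : 'cV[R[i]]_m) : (exists x, A *m x = b) -> A *m (mp_pinv A *m b) = b.
Proof. by have [AXA _ _ _] := mp_pinvP; move=> [x <-]; rewrite !mulmxA AXA. Qed.

Lemma mp_pinv_range (b : 'cV[R[i]]_m) : exists z, mp_pinv A *m b = A^t* *m z.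
Proof.
have [_ XAX _ tXA] := mp_pinvP.
(* With X the pseudoinverse, X b = X A X b = (X A)^* X b = A^* X^* X b. *)
exists ((mp_pinv A)^t* *m (mp_pinv A *m b)).
by rewrite mulmxA -trmxC_mul tXA mulmxA XAX.
Qed.

(** The step adds a combination of columns of A^*. This invariant keeps the [lambda_min] bound
    applicable along the iteration. *)
Lemma kaczmarz_step_range b xs q x : (exists z, x - xs = A^t* *m z) ->
  exists z, kaczmarz_step A b q x - xs = A^t* *m z.
Proof.
move=> [z xE]; have rowT i : (row i A)^t* = A^t* *m (delta_mx 0 i)^t*.
  by rewrite rowE trmxC_mul.
exists (z + coeff A b q.1 q.2 x *: (delta_mx 0 q.1)^t*
  + coeff A b q.2 q.1 x *: (delta_mx 0 q.2)^t*).
rewrite /kaczmarz_step !rowT !mulmxDr -xE -!scalemxAr.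
by rewrite (addrAC _ _ (- xs)) (addrAC _ _ (- xs)).
Qed.

(* The mean squared error after one step from a nonzero error is nonnegative. *)
Lemma kaczmarz_gain_le1 : N != 0 -> kaczmarz_gain <= 1.
Proof.
move=> N0; have /matrix0Pn[i [j Aij]] : A != 0.
  apply: contraTneq (spectral_norm_lt_frob N0) => A0.
  rewrite -leNgt (_ : F2 = 0) ?sqr_ge0// A0 frob_sqr.
  by rewrite big1// => i _; rewrite big1// => j _; rewrite mxE /cabs normr0 expr0n.
(* This is the conjugate transpose of a nonzero row; with b = 0 and xs = 0 it is itself an error in
   the range of A^*. *)
pose e := A^t* *m delta_mx i (0 : 'I_1).
have e0 : 0 < frob e ^+ 2.
  rewrite lt_neqAle sqr_ge0 andbT eq_sym; apply: contra_neq Aij => /frob_sqr_eq0.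
  move=> /matrixP/(_ j 0); rewrite /e -colE !mxE => /eqP.
  by rewrite conjC_eq0 => /eqP.
rewrite -subr_ge0 -(pmulr_lge0 _ e0).
have := @mean_kaczmarz_step_le 0 0 e (delta_mx i 0) N0 (mulmx0 _ _).
rewrite subr0 => /(_ erefl); apply: le_trans; apply: sumr_ge0 => q _.
by rewrite mulr_ge0 ?sqr_ge0 ?pair_prob_ge0.
Qed.

End Spectrum.

(** * Expectations along an i.i.d. sequence with finitely many values *)

Section FiniteExpectation.
Variables (d : measure_display) (T : measurableType d) (R : realType).
Variables (P : probability T R) (S : finType) (X : T -> S).
Hypothesis mX : forall s, measurable (X @^-1` [set s]).

(** The integrand is a finite sum of indicators of the fibres of X, and nonnegativity permits
    exchanging sum and integral. *)
Lemma expectation_finite (f : S -> R) : (forall s, 0 <= f s) ->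
  ('E_P[f \o X] = (\sum_s f s * fine (P (X @^-1` [set s])))%R%:E)%E.
Proof.
move=> f0; rewrite unlock.
have -> : (fun w => ((f \o X) w)%:E) =
    (fun w => \sum_s (f s * \1_(X @^-1` [set s]) w)%:E)%E.
  apply/funext => w; rewrite sumEFin (bigD1 (X w))//= indicE mem_set//= mulr1.
  rewrite big1 ?addr0// => s sX; rewrite indicE memNset ?mulr0// => Xw.
  by move: sX; rewrite Xw eqxx.
rewrite ge0_integral_sum//; last first.
  by move=> s w _; rewrite lee_fin mulr_ge0.
  by move=> s; apply/measurable_EFinP; apply: measurable_funM => //;
    exact: measurable_indic.
rewrite -sumEFin; apply: eq_bigr => s _.
rewrite (integralZl_indic _ (fun=> X @^-1` [set s]))//; last by rewrite ltNge f0.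
by rewrite integral_indic// setIT EFinM fineK// fin_num_measure.
Qed.

End FiniteExpectation.

(** * Contraction in expectation for a recursion driven by independent draws *)

Section IidContraction.
Variables (d : measure_display) (T : measurableType d) (R : realType).
Variables (P : probability T R) (S : finType) (X : nat -> T -> S) (pi : S -> R).
Hypothesis mX : forall k (B : set S), measurable (X k @^-1` B).
Hypothesis lawX : forall k s, P (X k @^-1` [set s]) = (pi s)%:E.
Hypothesis indX : mutually_independent P X.

(** The past is bundled into a value of a finite type, so that conditioning on it reduces to finite
    sums. *)
Let history k w : k.-tuple S := [tuple of [seq X l w | l <- iota 0 k]].

(* The default [s] of [nth] is arbitrary here; [history_joint] takes it to be the
   next draw, so that the index [k = size t] reads off [s]. *)
Let history_fiber k (t : k.-tuple S) s :
  history k @^-1` [set t] =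
  \bigcap_(l in [set` iota 0 k]) (X l @^-1` [set nth s t l]).
Proof.
apply/seteqP; split => w /=.
  move=> <- l /=; rewrite mem_iota add0n => /andP[_ lk].
  by rewrite (nth_map 0)%N ?size_iota// nth_iota.
move=> wt; apply/val_inj/(@eq_from_nth _ s); rewrite ?size_tuple// => l lk /=.
rewrite (nth_map 0)%N ?size_iota// nth_iota//.
by apply: wt; rewrite /= mem_iota.
Qed.

Let measurable_history k (t : k.-tuple S) : measurable (history k @^-1` [set t]).
Proof.
(* The default of [nth] requires an element of S; if S is empty, so is the sample space. *)
case: (pselect (exists s : S, True)) => [[s _]|noS].
  rewrite (history_fiber t s).
  by apply: fin_bigcap_measurable => // l _; exact: mX.
rewrite (_ : _ @^-1` _ = set0)//; apply/seteqP; split => // w _.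
by apply: noS; exists (X 0%N w).
Qed.

(** The event fixes the draws 0 to k; independence splits it into a product whose last factor is the
    law of draw k. *)
Let history_joint k (t : k.-tuple S) s :
  P ((fun w => (history k w, X k w)) @^-1` [set (t, s)]) =
  (P (history k @^-1` [set t]) * (pi s)%:E)%E.
Proof.
rewrite (history_fiber t s) indX ?iota_uniq//.
transitivity (P (\bigcap_(l in [set` iota 0 k.+1]) (X l @^-1` [set nth s t l]))).
  congr (P _); rewrite -[k.+1]addn1 iotaD; apply/seteqP; split => w /=.
    move=> [wt wk] l /=; rewrite mem_cat add0n mem_seq1 => /orP[lk|/eqP ->].
      have : (history k @^-1` [set t]) w by exact: wt.
      by rewrite (history_fiber t s); apply.
    by rewrite nth_default ?size_tuple.
  move=> wt; have wk : X k w = s.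
    have := wt k; rewrite /= nth_default ?size_tuple//; apply.
    by rewrite mem_cat add0n mem_seq1 eqxx orbT.
  congr (_, _) => //; have : (history k @^-1` [set t]) w => //.
  by rewrite (history_fiber t s) => l lk; apply: wt; rewrite /= mem_cat lk.
rewrite indX ?iota_uniq// -[k.+1]addn1 iotaD big_cat big_seq1 add0n.
by rewrite nth_default ?size_tuple// lawX.
Qed.

Variables (V : Type) (step : S -> V -> V) (phi : V -> R) (good : V -> Prop).
Hypothesis phi_ge0 : forall x, 0 <= phi x.
Hypothesis good_step : forall s x, good x -> good (step s x).
Variable rho : R.
Hypothesis rho_ge0 : 0 <= rho.
Hypothesis contraction : forall x, good x ->
  \sum_s pi s * phi (step s x) <= rho * phi x.
Variable x0 : V.
Hypothesis good0 : good x0.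

Fixpoint run (s : nat -> S) (k : nat) : V :=
  if k is k'.+1 then step (s k') (run s k') else x0.

Let endpoint (t : seq S) : V := foldl (fun x s => step s x) x0 t.

(** The state after k steps is a function of the first k draws alone. *)
Let runE w k : run (X^~ w) k = endpoint (history k w).
Proof.
elim: k => // k IH; rewrite [LHS]/= IH /endpoint -[RHS]/(foldl _ _ (map _ _)).
by rewrite -[in RHS]addn1 iotaD map_cat foldl_cat add0n.
Qed.

Let good_endpoint t : good (endpoint t).
Proof.
elim/last_ind: t => [//|t s IH]; rewrite /endpoint -cats1 foldl_cat /=.
exact: good_step.
Qed.

Lemma iid_expectation_le k :
  ('E_P[fun w => phi (run (X^~ w) k)] <= (rho ^+ k * phi x0)%:E)%E.
Proof.
pose prob k t := fine (P (history k @^-1` [set t])).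
have EE j : ('E_P[fun w => phi (run (X^~ w) j)] =
    (\sum_(t : j.-tuple S) phi (endpoint t) * prob j t)%R%:E)%E.
  rewrite -(expectation_finite P (@measurable_history j) (f := fun t => phi (endpoint t)))//.
  by congr ('E_P[_])%E; apply/funext => w; rewrite runE.
have ES j : ('E_P[fun w => phi (run (X^~ w) j.+1)] <=
    rho%:E * 'E_P[fun w => phi (run (X^~ w) j)])%E.
  rewrite (EE j).
  (* Pairing the history with the next draw replaces conditional expectation: for each fixed
     history, [contraction] bounds the sum over the draw. *)
  have -> : (fun w => phi (run (X^~ w) j.+1)) =
      (fun ts : j.-tuple S * S => phi (step ts.2 (endpoint ts.1)))
      \o (fun w => (history j w, X j w)).
    by apply/funext => w; rewrite /= runE.
  rewrite expectation_finite//; last first.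
    move=> [t s]; rewrite (_ : _ @^-1` _ =
        (history j @^-1` [set t]) `&` (X j @^-1` [set s])).
      by apply: measurableI.
    by apply/seteqP; split => w /= [-> ->].
  rewrite -EFinM lee_fin mulr_sumr.
  rewrite (eq_bigr (fun ts : j.-tuple S * S => phi (step ts.2 (endpoint ts.1)) *
      (prob j ts.1 * pi ts.2))) => [|[t s] _]; last first.
    by rewrite history_joint fineM ?fin_num_measure.
  rewrite -(pair_bigA _ (fun (t : j.-tuple S) s =>
      phi (step s (endpoint t)) * (prob j t * pi s))) /=.
  apply: ler_sum => t _; rewrite mulrA.
  apply: le_trans (ler_wpM2r _ (contraction (good_endpoint t))); last first.
    by rewrite fine_ge0.
  rewrite mulr_suml; apply: ler_sum => s _.
  by rewrite mulrCA mulrC -mulrA mulrCA mulrA.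
elim: k => [|k IH].
  by rewrite expr0 mul1r /= expectation_cst.
apply: le_trans (ES k) _; rewrite exprS -mulrA EFinM.
by apply: lee_wpmul2l.
Qed.

End IidContraction.

Theorem theorem3p2 (R : realType) (m n : nat)
    (A : 'M[R[i]]_(m, n)) (b : 'cV[R[i]]_m)
    (consistent : exists x : 'cV[R[i]]_n, A *m x = b)
    (nondegenerate : frob A ^+ 4 != frob (A *m A^t*) ^+ 2)
    (x0 : 'cV[R[i]]_n)
    (x0_range : exists y : 'cV[R[i]]_m, x0 = A^t* *m y)
    (d : measure_display) (T : measurableType d) (P : probability T R)
    (p : nat -> T -> 'I_m * 'I_m) (sampling : row_sampling P A p) :
  let xstar := mp_pinv A *m b in
  let x := fun (k : nat) (w : T) => kaczmarz A b x0 (fun l => p l w) k in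
  ('E_P[fun w => (frob (x k w - xstar) ^+ 2)%R] @[k --> \oo] --> (0%R : R)%:E)%E
  /\
  forall k : nat,
    ('E_P[fun w => (frob (x k.+1 w - xstar) ^+ 2)%R]
     <= ((1 - (2 * frob A ^+ 4 - 2 * frob A ^+ 2 * spectral_norm A ^+ 2)
                / (frob A ^+ 4 - frob (A *m A^t*) ^+ 2)
              * (lambda_min (A^t* *m A) / frob A ^+ 2)) ^+ k.+1
         * frob (x0 - xstar) ^+ 2)%R%:E)%E.
Proof.
move=> xstar x.
have N0 : frob A ^+ 4 - frob (A *m A^t*) ^+ 2 != 0 by rewrite subr_eq0.
have [mp lawp indp] := sampling.
have xstar_sol : A *m xstar = b := mp_pinv_solution consistent.
have rho_ge0 : 0 <= 1 - kaczmarz_gain A by rewrite subr_ge0 kaczmarz_gain_le1.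
(* Both x0 and xstar lie in the range of A^*. An error component in the kernel of A would be left
   unchanged by every step. *)
have range0 : exists z, x0 - xstar = A^t* *m z.
  have [y ->] := x0_range; have [z zE] := mp_pinv_range A b.
  by exists (y - z); rewrite mulmxBr /xstar zE.
have xE w k : x k w = run (kaczmarz_step A b) x0 (p^~ w) k.
  by rewrite /x; elim: k => //= k ->.
have bound k : ('E_P[fun w => (frob (x k w - xstar) ^+ 2)%R] <=
    ((1 - kaczmarz_gain A) ^+ k * frob (x0 - xstar) ^+ 2)%R%:E)%E.
  under eq_fun do rewrite xE.
  apply: (iid_expectation_le mp lawp indp
    (phi := fun x => frob (x - xstar) ^+ 2)
    (good := fun x => exists z, x - xstar = A^t* *m z)) => //.
  - by move=> y; exact: sqr_ge0.
  - by move=> q y; exact: kaczmarz_step_range.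
  - by move=> y [z yE]; exact: mean_kaczmarz_step_le yE.
split; last by move=> k; exact: bound k.+1.
(* The expectation lies between 0 and a geometric sequence whose ratio is in [0, 1) because the gain
   is positive and at most 1. *)
apply: (@squeeze_cvge _ _ _ _ (fun=> 0%E) _
  (fun k => ((1 - kaczmarz_gain A) ^+ k * frob (x0 - xstar) ^+ 2)%:E)).
- by apply: nearW => k; rewrite bound andbT expectation_ge0// => w; exact: sqr_ge0.
- exact: cvg_cst.
apply: cvg_EFin; first by apply: nearW.
rewrite -[X in _ --> X](mul0r (frob (x0 - xstar) ^+ 2)).
apply: cvgMr_tmp; apply: cvg_expr; rewrite ger0_norm//.
by rewrite ltrBlDr ltrDl kaczmarz_gain_gt0.
Qed.
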